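(* Let $F$ be a field of characteristic $\neq 2$ and $\alpha,\beta,\gamma\in F^\times$. Let $V$ be the 7-dimensional $F$-vector space with basis $v_0,\dots,v_6$ (indices in $\mathbb{Z}/7\mathbb{Z}$), and let $l_n=\{v_n,v_{n+1},v_{n+3}\}$ ($n\in\mathbb{Z}/7$) be the lines of the Fano plane on these points. Fix $\varepsilon\in\{0,1\}$ and equip each line with the cyclic order $(v_n,v_{n+1},v_{n+3})$ if $\varepsilon=0$, resp. $(v_{n+1},v_n,v_{n+3})$ if $\varepsilon=1$ (the same choice for all $n$). Define $h(l_1)=-\alpha$, $h(l_{-1})=-\beta$, $h(l_0)=-\gamma$ and $h(l_n)=1$ for $n\notin\{-1,0,1\}$. Let $W=\bigwedge^3V$, $\Delta=v_0\wedge v_1\wedge\cdots\wedge v_6\in\bigwedge^7V$, and for each line $l$ with cyclic order $(u_1,u_2,u_3)$ put $w_l=h(l)\,u_1\wedge u_2\wedge u_3\in W$. For each $j$ define the linear functional $\eta_{v_j}:W\to F$ by $v_j\wedge\big(\sum_{n}w_{l_n}\big)\wedge w=\eta_{v_j}(w)\Delta$. Let $$\mathfrak{B}=\{B\subseteq V \text{ 3-dimensional}: \eta_{v_j}(b_1\wedge b_2\wedge b_3)=0 \text{ for all } j, \text{ where } b_1,b_2,b_3 \text{ is a basis of } B\}.$$ Then $\mathfrak{B}$ is an inclusion-minimal $(7,3,2)$ $q$-covering design on $V$. Moreover, if the equation $$\lambda_0^2-\lambda_1^2\alpha-\lambda_2^2\beta-\lambda_3^2\gamma+\lambda_4^2\alpha\beta+\lambda_5^2\beta\gamma+\lambda_6^2\gamma\alpha-\lambda_7^2\alpha\beta\gamma=0$$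 has only the solution $\lambda_0=\dots=\lambda_7=0$ in $F$ (equivalently, the Cayley algebra $D_\gamma(D_\beta(D_\alpha(F)))$ is a division algebra), then $\mathfrak{B}$ is a $2$-$(7,3,1)$ subspace design ($q$-Fano plane) on $V$. (In particular, with $\alpha=\beta=\gamma=-1$ and $F\subseteq\mathbb{R}$, $\mathfrak{B}$ is a $q$-Fano plane.)
   Context: The condition $\eta_{v_j}(b_1\wedge b_2\wedge b_3)=0$ does not depend on the choice of basis of $B$. A $(v,k,t)$ $q$-covering design on a $v$-dimensional space is a set of $k$-dimensional subspaces such that every $t$-dimensional subspace lies in at least one of them; it is inclusion-minimal if no proper subset has this property. A $2$-$(7,3,1)$ subspace design: every 2-dimensional subspace lies in exactly one block. Cayley–Dickson doubling: for an algebra $A$ with involution $*$ and $\gamma\in F^\times$, $D_\gamma(A)=A\oplus A$ (elements $a+ib$) with $(a+ib)(c+id)=(ac+\gamma db^* )+i(a^*d+cb)$ and $(a+ib)^*=a^*-ib$, starting from $F$ with identity involution. *)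

(* Defs.v *)
From HB Require Import structures.
From mathcomp Require Import all_boot all_order all_algebra.
Set Implicit Arguments. Unset Strict Implicit. Unset Printing Implicit Defensive.
Import GRing.Theory.
Local Open Scope ring_scope.

Definition e (F : fieldType) (i : 'I_7) : 'rV[F]_7 := delta_mx 0 i.

Definition addI7 (n : 'I_7) (k : nat) : 'I_7 := inord ((n + k) %% 7).

Definition rows7 (F : fieldType) (s : seq 'rV[F]_7) : 'M[F]_7 :=
  \matrix_(i < 7, k < 7) (nth 0 s i) 0 k.

(* For 7 vectors x_1..x_7, x_1 /\ ... /\ x_7 = det(rows) * Delta, with
   Delta = v_0 /\ ... /\ v_6; this is the coefficient of a 7-form wrt Delta. *)
Definition wedge7 (F : fieldType) (s : seq 'rV[F]_7) : F := \det (rows7 s).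

Definition hw (F : fieldType) (a b c : F) (n : 'I_7) : F :=
  if val n == 1%N then - a
  else if val n == 6%N then - b
  else if val n == 0%N then - c
  else 1.

Definition line_pts (F : fieldType) (eps : bool) (n : 'I_7) : seq 'rV[F]_7 :=
  if eps then [:: e F (addI7 n 1); e F n; e F (addI7 n 3)]
  else [:: e F n; e F (addI7 n 1); e F (addI7 n 3)].

(* eta_{v_j}(b1 /\ b2 /\ b3): v_j /\ (sum_n w_{l_n}) /\ (b1/\b2/\b3) = eta * Delta,
   expanded by multilinearity of the wedge product. *)
Definition eta (F : fieldType) (a b c : F) (eps : bool) (j : 'I_7)
  (b1 b2 b3 : 'rV[F]_7) : F :=
  \sum_(n < 7) hw a b c n * wedge7 (e F j :: line_pts F eps n ++ [:: b1; b2; b3]).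

Definition frakB (F : fieldType) (a b c : F) (eps : bool)
  (B : {vspace 'rV[F]_7}) : Prop :=
  \dim B = 3%N /\
  forall bs : 3.-tuple 'rV[F]_7, basis_of B bs ->
    forall j : 'I_7, eta a b c eps j (tnth bs 0) (tnth bs 1) (tnth bs 2) = 0.

Definition q_covering (F : fieldType) (k t : nat)
  (S : {vspace 'rV[F]_7} -> Prop) : Prop :=
  (forall B, S B -> \dim B = k) /\
  (forall T : {vspace 'rV[F]_7}, \dim T = t -> exists B, S B /\ (T <= B)%VS).

Definition minimal_q_covering (F : fieldType) (k t : nat)
  (S : {vspace 'rV[F]_7} -> Prop) : Prop :=
  q_covering k t S /\
  (forall S' : {vspace 'rV[F]_7} -> Prop,
      (forall B, S' B -> S B) -> q_covering k t S' -> forall B, S B -> S' B).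

Definition subspace_design_2_7_3_1 (F : fieldType)
  (S : {vspace 'rV[F]_7} -> Prop) : Prop :=
  (forall B, S B -> \dim B = 3%N) /\
  (forall T : {vspace 'rV[F]_7}, \dim T = 2%N ->
     exists B, (S B /\ (T <= B)%VS) /\ forall B', S B' -> (T <= B')%VS -> B' = B).

Definition octonion_form (F : fieldType) (a b c : F) (l : 'I_8 -> F) : F :=
  l 0 ^+ 2 - l 1 ^+ 2 * a - l 2 ^+ 2 * b - l 3 ^+ 2 * c
  + l 4 ^+ 2 * (a * b) + l 5 ^+ 2 * (b * c) + l 6 ^+ 2 * (c * a)
  - l 7 ^+ 2 * (a * b * c).

(* Main.v *)
Require Import Defs.
From HB Require Import structures.
From mathcomp Require Import all_boot all_order all_algebra.
From mathcomp Require Import ring.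
Import GRing.Theory VectorInternalTheory.
Local Open Scope ring_scope.
Set Implicit Arguments. Unset Strict Implicit. Unset Printing Implicit Defensive.

(** [V] is the space of imaginary elements of the Cayley algebra
    [D_c(D_b(D_a(F)))]. Write [x *v y] for the imaginary part of the product; up to
    a common factor, [eta_{v_j}(x /\ y /\ z)] is the scalar product of [v_j] with
    the associator of [x], [y] and [z], so a block is a 3-space on which the
    associator vanishes.

    Covering: pairing the associator of [x], [y], [u] with [v] gives a
    skew-symmetric form in [u], [v] whose radical contains [x] and [y]. As [V] has
    odd dimension so has the radical, which is thus larger than [<x, y>].

    Uniqueness: if [x *v y] is not in [<x, y>], then the associator of [x], [y], [z]
    vanishes only for [z] in [<x, y, x *v y>], so this is the only block containing
    [x] and [y]. For [p = x *v y] of nonzero norm this is read off [p *v (p *v z)];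
    otherwise the plane [<x, y>] is degenerate, and a [z] outside would yield
    three independent vectors with pairwise products zero, which do not exist. If
    the norm is anisotropic, then [x *v y] is never in [<x, y>].

    Minimality: every 3-space contains [x], [y] with [x *v y] not in [<x, y>].
    Otherwise, as not all products vanish on it, it contains a vector [h] and two
    independent eigenvectors [v], [w] of [x |-> h *v x] for the same nonzero
    eigenvalue, but then [v *v w] is not in [<v, w>]. *)

Lemma v2rE (F : fieldType) (vT : vectType F) :
  (forall x y : vT, v2r (x + y) = v2r x + v2r y) *
  (forall x : vT, v2r (- x) = - v2r x) *
  (forall k (x : vT), v2r (k *: x) = k *: v2r x) *
  (v2r (0 : vT) = 0).
Proof. by do !split; move=> *; rewrite (linearD, linearN, linearZ, linear0). Qed.

Ltac lmod_ring := apply: v2r_inj; rewrite !v2rE; apply/rowP => ?; rewrite !mxE; ring.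

(** * Spans of two and three vectors *)

Section Span.
Variables (F : fieldType) (vT : vectType F).
Implicit Types x y z v : vT.

Lemma mem_span2 x y : x \in <<[:: x; y]>>%VS /\ y \in <<[:: x; y]>>%VS.
Proof. by split; apply: memv_span; rewrite !inE eqxx ?orbT. Qed.

Lemma span2_subv x y (U : {vspace vT}) : x \in U -> y \in U -> (<<[:: x; y]>> <= U)%VS.
Proof. by move=> xU yU; apply/span_subvP => v; rewrite !inE => /orP[]/eqP->. Qed.

Lemma mem_span2P x y v :
  reflect (exists p q, v = p *: x + q *: y) (v \in <<[:: x; y]>>%VS).
Proof.
rewrite span_cons span_seq1; apply: (iffP memv_addP).
  by case=> _ /vlineP[p ->] [_ /vlineP[q ->] ->]; exists p, q.
by case=> p [q ->]; exists (p *: x); [|exists (q *: y)]; rewrite ?memvZ ?memv_line.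
Qed.

Lemma mem_span_addZ x y z v t :
  v + t *: y \in <<[:: x; z]>>%VS -> v \in <<[:: x; y; z]>>%VS.
Proof.
move=> vtyU; have [xU yU zU] : [/\ x \in <<[:: x; y; z]>>%VS, y \in <<[:: x; y; z]>>%VS
    & z \in <<[:: x; y; z]>>%VS] by split; apply: memv_span; rewrite !inE eqxx ?orbT.
rewrite -[v](addrK (t *: y)) memvB ?memvZ //.
exact: subvP (span2_subv xU zU) _ vtyU.
Qed.

Lemma freeC x y : free [:: x; y] = free [:: y; x].
Proof. exact: perm_free (permEl (perm_catC [:: x] [:: y])). Qed.

Lemma free2P x y :
  free [:: x; y] <-> forall p q, p *: x + q *: y = 0 -> p = 0 /\ q = 0.
Proof.
split=> [/(@freeP _ _ _ [tuple x; y]) freeX p q sum0 | ind].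
  have := freeX (tnth [tuple p; q]); rewrite !big_ord_recl big_ord0 addr0.
  by move/(_ sum0) => k0; split; [exact: (k0 0) | exact: (k0 1)].
apply/(@freeP _ _ _ [tuple x; y]) => k; rewrite !big_ord_recl big_ord0 addr0.
move=> /ind[k0 k1] i; case: i => [[|[|//]] lti].
  by rewrite -k0; congr k; apply: val_inj.
by rewrite -k1; congr k; apply: val_inj.
Qed.

Lemma free3_eq0 x y z p q r : free [:: x; y; z] ->
  p *: x + q *: y + r *: z = 0 -> [/\ p = 0, q = 0 & r = 0].
Proof.
move=> /(@freeP _ _ _ [tuple x; y; z]) freeX sum0.
have := freeX (tnth [tuple p; q; r]); rewrite !big_ord_recl big_ord0 addr0 addrA.
by move/(_ sum0) => k0; split; [exact: (k0 0) | exact: (k0 1) | exact: (k0 2)].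
Qed.

Lemma dim2_basis (T : {vspace vT}) : \dim T = 2%N -> exists x y, basis_of T [:: x; y].
Proof.
move=> dimT; have := vbasisP T; move: (vbasis T); rewrite dimT.
by case=> [[|x [|y []]]] //= _ bT; exists x, y.
Qed.

Lemma dim3_basis (B : {vspace vT}) : \dim B = 3%N -> exists x y z, basis_of B [:: x; y; z].
Proof.
move=> dimB; have := vbasisP B; move: (vbasis B); rewrite dimB.
by case=> [[|x [|y [|z []]]]] //= _ bB; exists x, y, z.
Qed.

End Span.

(** * Skew-symmetric forms *)

Section SkewForm.
Variables (F : fieldType) (vT : vectType F) (s : {skew_symmetric vT}).
Hypothesis nz2 : 2%:R != 0 :> F.
Implicit Types (U : {vspace vT}) (u v : vT).

Lemma skew_form_diag u : s u u = 0.
Proof.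
have /eqP : s u u = - s u u by rewrite {1}hermC mulN1r.
by rewrite -addr_eq0 -mulr2n -mulr_natl mulf_eq0 (negbTE nz2) => /eqP.
Qed.

Lemma dim_cap_orthov1 U u :
  u \notin orthov s U -> (\dim (U :&: orthov s <[u]>)).+1 = \dim U.
Proof.
move=> NuU; rewrite -(eq_dim_orthov1 NuU) prednK // lt0n dimv_eq0.
apply: contraNneq NuU => ->; apply/mem_orthovP => v.
by rewrite memv0 => /eqP->; rewrite linear0r.
Qed.

Lemma cap_orthov_hyperbolic U u v : u \in U -> v \in U -> s u v != 0 ->
  let W := (U :&: orthov s <[u]> :&: orthov s <[v]>)%VS in
  (W :&: orthov s W = U :&: orthov s U)%VS.
Proof.
move=> uU vU suv W; have svu : s v u != 0 by rewrite herm_eq0C.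
apply/vspaceP => z; rewrite !memv_cap !mem_orthov1.
apply/andP/andP => [[/andP[/andP[zU /eqP szu] /eqP szv] /mem_orthovP zW]|[zU /mem_orthovP szU]].
  split=> //; apply/mem_orthovP => t tU.
  suff /zW : t - (s t v / s u v) *: u - (s t u / s v u) *: v \in W.
    by rewrite !linearBr !linearZr_LR /= szu szv !mulr0 !subr0.
  rewrite !memv_cap !mem_orthov1 !(memvB, memvZ) //= !linearBl !linearZl_LR /=.
  by rewrite !skew_form_diag !mulr0 !divfK // !subr0 !subrr eqxx.
split; last by apply/mem_orthovP => t; rewrite !memv_cap => /andP[/andP[/szU]].
by rewrite zU !szU // eqxx.
Qed.

Lemma odd_dim_cap_orthov U : odd (\dim (U :&: orthov s U)) = odd (\dim U).
Proof.
have [n] := ubnP (\dim U); elim: n U => // n IHn U; rewrite ltnS => leUn.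
have [/capv_idPl -> //|/subvPn[u uU NuU]] := boolP (U <= orthov s U)%VS.
have /mem_orthovPn[v vU suv] := NuU.
have NvU : v \notin orthov s (U :&: orthov s <[u]>).
  apply/mem_orthovPn; exists u; last by rewrite herm_eq0C.
  by rewrite memv_cap uU mem_orthov1 skew_form_diag eqxx.
have dimU := dim_cap_orthov1 NuU; have dimUu := dim_cap_orthov1 NvU.
rewrite -(cap_orthov_hyperbolic uU vU suv) IHn; last first.
  by rewrite -dimU -dimUu in leUn; apply: leq_trans leUn; rewrite ltnW.
by rewrite -dimU -dimUu /= negbK.
Qed.

End SkewForm.

(** * Cross products *)

Section CrossProduct.
Variables (F : fieldType) (V : vectType F).
Variables (dot : {symmetric V}) (cross : {bilinear V -> V -> V}).
Implicit Types (x y z u v w h : V) (k : F) (B T : {vspace V}).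

Local Notation "''[' u , v ]" := (dot u v) : ring_scope.
Local Notation "x *v y" := (cross x y) (at level 40, left associativity).

Record cross_product : Prop := CrossProduct {
  crossvv : forall x, x *v x = 0;
  dot_crossA : forall x y z, '[x *v y, z] = '[x, y *v z];
  cross_crossK : forall x y, x *v (x *v y) = '[x, y] *: x - '[x, x] *: y }.

(* This is -1/2 times the associator of the algebra F + V in which the product of
   two vectors is [x y = - '[x, y] + x *v y]. *)
Definition associator x y z := x *v (y *v z) + '[x, y] *: z - '[x, z] *: y.

Fact associator_is_linear x y : linear (associator x y).
Proof.
by move=> k z w; rewrite /associator !(linearDr, linearZr_LR) /=; lmod_ring.
Qed.

HB.instance Definition _ x y :=
  GRing.isLinear.Build F V V _ (associator x y) (associator_is_linear x y).

Definition associative_block B :=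
  \dim B = 3%N /\ {in B & &, forall x y z, associator x y z = 0}.

Definition cross_span x y := <<[:: x *v y; x; y]>>%VS.

Lemma dotC x y : '[x, y] = '[y, x].
Proof. by rewrite hermC mul1r. Qed.

Hypothesis crossP : cross_product.

Lemma crossC x y : y *v x = - (x *v y).
Proof.
apply/eqP; rewrite -addr_eq0 addrC; have /eqP := crossvv crossP (x + y).
by rewrite linearDl !linearDr !(crossvv crossP) add0r addr0.
Qed.

Lemma cross_crossD x y z :
  x *v (y *v z) + y *v (x *v z) = '[y, z] *: x + '[x, z] *: y - (2%:R * '[x, y]) *: z.
Proof.
transitivity ((x + y) *v ((x + y) *v z) - x *v (x *v z) - y *v (y *v z)).
  by rewrite !(linearDl, linearDr) /=; lmod_ring.
by rewrite !(cross_crossK crossP) !(linearDl, linearDr) /= (dotC y x); lmod_ring.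
Qed.

Lemma cross_crossl x y : x *v y *v x = '[x, x] *: y - '[x, y] *: x.
Proof. by rewrite crossC (cross_crossK crossP) opprB. Qed.

Lemma cross_crossr x y : x *v y *v y = '[x, y] *: y - '[y, y] *: x.
Proof. by rewrite crossC (crossC y) linearNr opprK (cross_crossK crossP) dotC. Qed.

Lemma dot_crossl x y : '[x *v y, x] = 0.
Proof. by rewrite dotC -(dot_crossA crossP) (crossvv crossP) linear0l. Qed.

Lemma dot_crossr x y : '[x *v y, y] = 0.
Proof. by rewrite (dot_crossA crossP) (crossvv crossP) linear0r. Qed.

Lemma dot_cross_skew x y z : '[x *v y, z] = - '[y, x *v z].
Proof. by rewrite (crossC y) linearNl /= (dot_crossA crossP). Qed.

Lemma dot_cross_cross x y : '[x *v y, x *v y] = '[x, x] * '[y, y] - '[x, y] ^+ 2.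
Proof.
rewrite dot_cross_skew (cross_crossK crossP) linearBr !linearZr_LR /= (dotC y x); ring.
Qed.

Lemma associatorC12 x y z : associator y x z = - associator x y z.
Proof.
apply/eqP; rewrite -addr_eq0 /associator.
transitivity (x *v (y *v z) + y *v (x *v z)
  - ('[y, z] *: x + '[x, z] *: y - (2%:R * '[x, y]) *: z) == 0).
  by congr (_ == 0); rewrite (dotC y x); lmod_ring.
by rewrite cross_crossD subrr eqxx.
Qed.

Lemma associatorC23 x y z : associator x z y = - associator x y z.
Proof. by rewrite /associator (crossC y z) linearNr /=; lmod_ring. Qed.

Lemma associator_rot x y z : associator y z x = associator x y z.
Proof. by rewrite associatorC23 associatorC12 opprK. Qed.

Lemma associatorxxy x y : associator x x y = 0.
Proof. by rewrite /associator (cross_crossK crossP) addrNK subrr. Qed.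

Lemma associatorxyx x y : associator x y x = 0.
Proof. by rewrite associatorC23 associatorxxy oppr0. Qed.

Lemma associatorxyy x y : associator x y y = 0.
Proof. by rewrite -associator_rot associatorxxy. Qed.

Lemma dot_associator_skew x y z w : '[associator x y z, w] = - '[associator x y w, z].
Proof.
have swap : '[x *v (y *v z), w] = '[y *v (x *v w), z].
  by rewrite dot_cross_skew dot_cross_skew opprK dotC.
have sym : '[x *v (y *v w), z] + '[y *v (x *v w), z]
    = '[y, w] * '[x, z] + '[x, w] * '[y, z] - 2%:R * '[x, y] * '[w, z].
  rewrite -linearDl /= cross_crossD !(linearDl, linearNl) !linearZl_LR; ring.
rewrite /associator !(linearDl, linearNl) !linearZl_LR /= swap.
rewrite (canRL (addrK _) sym) (dotC z w); ring.
Qed.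

Lemma associator_span3 x y z : associator x y z = 0 ->
  {in <<[:: x; y; z]>>%VS & &, forall u v w, associator u v w = 0}.
Proof.
move=> assoc0; set X := [:: x; y; z].
have span_ker u v : {in X, forall w, associator u v w = 0} ->
    {in <<X>>%VS, forall w, associator u v w = 0}.
  move=> uvX w wX; apply/eqP; rewrite -[associator u v w]lfunE -memv_ker.
  move: w wX; apply/subvP/span_subvP => w wX; rewrite memv_ker lfunE; apply/eqP; exact: uvX.
have assocX : {in X & X & <<X>>%VS, forall u v w, associator u v w = 0}.
  move=> u v w uX vX; move: w; apply: span_ker => w wX; move: uX vX wX; rewrite !inE.
  have yzx : associator y z x = 0 by rewrite associator_rot.
  have zxy : associator z x y = 0 by rewrite -associator_rot.
  have yxz : associator y x z = 0 by rewrite associatorC12 assoc0 oppr0.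
  have xzy : associator x z y = 0 by rewrite associatorC23 assoc0 oppr0.
  have zyx : associator z y x = 0 by rewrite associatorC12 yzx oppr0.
  by do 3!case/or3P=> /eqP->; rewrite ?associatorxxy ?associatorxyx ?associatorxyy.
have assocXX : {in X & <<X>>%VS & <<X>>%VS, forall u v w, associator u v w = 0}.
  move=> u v w uX vX wX; rewrite -[LHS]opprK -associatorC23.
  by rewrite (span_ker u w _ v vX) ?oppr0 // => t tX; rewrite associatorC23 assocX ?oppr0.
move=> u v w uX vX wX; rewrite -associator_rot.
by apply: (span_ker v w) uX => t tX; rewrite associator_rot assocXX.
Qed.

Lemma mem_cross_span x y : x *v y \in cross_span x y.
Proof. exact: memv_span (mem_head _ _). Qed.

Lemma span2_sub_cross_span x y : (<<[:: x; y]>> <= cross_span x y)%VS.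
Proof. exact: sub_span (@mem_behead _ [:: x *v y; x; y]). Qed.

Lemma cross_spanS x y u v : u \in <<[:: x; y]>>%VS -> v \in <<[:: x; y]>>%VS ->
  (cross_span u v <= cross_span x y)%VS.
Proof.
move=> uU vU; have subU : {subset <<[:: x; y]>>%VS <= cross_span x y}.
  exact: subvP (span2_sub_cross_span x y).
apply/span_subvP => w; rewrite !inE => /or3P[] /eqP->; [|exact: subU|exact: subU].
have [[p [q ->]] [r [s ->]]] := (mem_span2P _ _ _ uU, mem_span2P _ _ _ vU).
rewrite (_ : _ *v _ = (p * s - q * r) *: (x *v y)).
  by rewrite memvZ ?mem_cross_span.
rewrite !(linearDl, linearDr) !(linearZl_LR, linearZr_LR) /= !(crossvv crossP) (crossC x y).
lmod_ring.
Qed.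

Lemma free_of_cross_notin x y : x *v y \notin <<[:: x; y]>>%VS -> free [:: x; y].
Proof.
rewrite freeC free_cons span_seq1 seq1_free => Nxy; apply/andP; split.
  apply: contraNN Nxy => /vlineP[p ->].
  by rewrite linearZr_LR /= (crossvv crossP) scaler0 mem0v.
by apply: contraNneq Nxy => ->; rewrite linear0l mem0v.
Qed.

Lemma cross_notin_anisotropic x y : (forall v, '[v, v] = 0 -> v = 0) ->
  free [:: x; y] -> x *v y \notin <<[:: x; y]>>%VS.
Proof.
move=> aniso fxy; apply/negP => /mem_span2P[p [q xyE]].
have xy0 : x *v y = 0.
  by apply: aniso; rewrite {2}xyE linearDr !linearZr_LR /= dot_crossl dot_crossr !mulr0 addr0.
have := cross_crossK crossP x y; rewrite xy0 linear0r -scaleNr.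
move=> /esym/((free2P _ _).1 fxy)[_ /eqP]; rewrite oppr_eq0 => /eqP/aniso x0.
by have := free_not0 fxy (mem_head x _); rewrite x0 eqxx.
Qed.

Hypotheses (nz2 : 2%:R != 0 :> F) (nondeg : nondegenerate dot).

Lemma exists_dot_neq0 x : x != 0 -> exists w, '[x, w] != 0.
Proof.
move=> nz_x; suff /mem_orthovPn[w _ xw] : x \notin orthov dot fullv by exists w.
by move/eqP: nondeg => ->; rewrite memv0.
Qed.

Section CrossEigenvectors.
Variables (h : V) (k : F).
Hypothesis nzk : k != 0.

Lemma dot_cross_eigen v : h *v v = k *: v -> '[h, v] = 0.
Proof.
move=> hv; have /eqP := dot_crossl h v.
by rewrite hv linearZl_LR /= mulf_eq0 (negbTE nzk) dotC => /eqP.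
Qed.

Lemma dot_cross_eigenvectors v w : h *v v = k *: v -> h *v w = k *: w -> '[v, w] = 0.
Proof.
move=> hv hw; have /eqP := dot_cross_skew h v w.
rewrite hv hw linearZl_LR linearZr_LR /= -addr_eq0 -mulr2n -mulr_natl !mulf_eq0.
by rewrite (negbTE nz2) (negbTE nzk) => /eqP.
Qed.

Lemma free_cross_eigen v : h *v v = k *: v -> v != 0 -> free [:: h; v].
Proof.
move=> hv nz_v; rewrite free_cons span_seq1 seq1_free nz_v andbT.
apply: contraNN nz_v => /vlineP[p hE]; move/eqP: hv.
by rewrite {1}hE linearZl_LR /= (crossvv crossP) scaler0 eq_sym scaler_eq0 (negbTE nzk).
Qed.

Lemma cross_eigen_cross v w : h *v v = k *: v ->
  h *v (v *v w) = - k *: (v *v w) - '[v, w] *: h + (2%:R * '[h, w]) *: v.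
Proof.
move=> hv; have := associator_rot w h v; rewrite /associator hv (dot_cross_eigen hv).
rewrite linearZr_LR /= (crossC v w) (dotC w) (dotC w) => /(canRL (addrK _)) E.
rewrite -[LHS]addr0 -(scale0r w) E; lmod_ring.
Qed.

Lemma cross_eigenvectors_eq0 v w : h *v v = k *: v -> h *v w = k *: w ->
  v *v w \in <<[:: v; w]>>%VS -> v *v w = 0.
Proof.
move=> hv hw /mem_span2P[p [q vwE]].
have h_vw : h *v (v *v w) = k *: (v *v w).
  by rewrite {1}vwE linearDr !linearZr_LR /= hv hw vwE; lmod_ring.
have := cross_eigen_cross w hv.
rewrite h_vw (dot_cross_eigen hw) (dot_cross_eigenvectors hv hw) mulr0 !scale0r subr0 addr0.
move/eqP; rewrite scaleNr -addr_eq0 -scalerDl -mulr2n scaler_eq0 -mulr_natl mulf_eq0.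
by rewrite (negbTE nz2) (negbTE nzk) => /eqP.
Qed.

(* [h *v (v *v (w *v u))] is evaluated both by [cross_eigen_cross] and after expanding
   [v *v (w *v u)]. *)
Lemma cross_eigenvectors_dependent v w u : h *v v = k *: v -> h *v w = k *: w ->
  v *v w = 0 -> '[v, u] *: w = '[w, u] *: v.
Proof.
move=> hv hw vw0.
have vwu : v *v (w *v u) = (2%:R * '[v, u]) *: w - '[w, u] *: v.
  have := associator_rot u v w; rewrite /associator vw0 (dot_cross_eigenvectors hv hw).
  rewrite linear0r (dotC u) (dotC u) => /(canRL (addrK _)) E.
  rewrite -[LHS]addr0 -(scale0r u) E; lmod_ring.
have := cross_eigen_cross (w *v u) hv.
rewrite vwu linearBr !linearZr_LR /= hv hw -!(dot_crossA crossP) vw0 hw linear0l linearZl_LR /=.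
move/eqP; rewrite -subr_eq0.
rewrite (_ : _ - _ = (2%:R * 2%:R * k) *: ('[v, u] *: w - '[w, u] *: v)); last by lmod_ring.
by rewrite scaler_eq0 !mulf_eq0 (negbTE nz2) (negbTE nzk) subr_eq0 => /eqP.
Qed.

Lemma cross_eigenvectors_notin v w : free [:: v; w] ->
  h *v v = k *: v -> h *v w = k *: w -> v *v w \notin <<[:: v; w]>>%VS.
Proof.
move=> fvw hv hw; apply/negP => /(cross_eigenvectors_eq0 hv hw) vw0.
have [u vu] := exists_dot_neq0 (free_not0 fvw (mem_head v _)).
move: fvw; rewrite freeC free_cons span_seq1 => /andP[/negP[]].
have := rpredZeq <[v]>%VS '[v, u] w; rewrite (negbTE vu) /= => <-.
by rewrite (cross_eigenvectors_dependent u hv hw vw0) memvZ ?memv_line.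
Qed.

(* On [<h, v, z> / <h>] the map [cross h] has eigenvectors [v], [z] and [v + z], so it is
   the scalar [k]. *)
Lemma cross_eigen_extend v z : free [:: h; v; z] -> h *v v = k *: v ->
  h *v z \in <<[:: h; z]>>%VS -> h *v (v + z) \in <<[:: h; (v + z)%R]>>%VS ->
  exists r, h *v (z + r *: h) = k *: (z + r *: h).
Proof.
move=> fr hv /mem_span2P[r [s hz]] /mem_span2P[p [q hvz]].
have [_ q_k s_q] : [/\ p - r = 0, q - k = 0 & q - s = 0].
  apply: (free3_eq0 fr); transitivity (h *v (v + z) - (h *v v + h *v z)).
    by rewrite hvz hv hz; lmod_ring.
  by rewrite linearDr subrr.
exists (r / k); rewrite linearDr linearZr_LR /= (crossvv crossP) scaler0 addr0 hz.
by rewrite -(subr0_eq s_q) (subr0_eq q_k) addrC scalerDr scalerA mulrC divfK.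
Qed.

End CrossEigenvectors.

Lemma dot_of_cross_eq0 x y : free [:: x; y] -> x *v y = 0 -> '[x, y] = 0 /\ '[x, x] = 0.
Proof.
move=> /free2P fxy xy0; have := cross_crossK crossP x y.
rewrite xy0 linear0r => /esym; rewrite -scaleNr => /fxy[-> /eqP].
by rewrite oppr_eq0 => /eqP.
Qed.

Lemma cross_cross_eigen x w v : x *v v = 0 -> '[x, v] = 0 -> '[v, w] = 0 ->
  x *v w *v v = '[x, w] *: v.
Proof.
move=> xv0 xv vw; have := associator_rot w v x.
rewrite /associator (crossC x v) xv0 oppr0 linear0r (crossC (x *v w)) (dotC v x) xv (dotC w v) vw.
by rewrite !scale0r subr0 add0r sub0r addr0 (dotC x) => /oppr_inj.
Qed.

(* For [w] with ['[x, w] != 0], the projections of [y] and [z] to the orthogonal of [w]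
   along [x] are eigenvectors of [cross (x *v w)] with product zero. *)
Lemma cross_eq0_dependent x y z :
  x *v y = 0 -> x *v z = 0 -> y *v z = 0 -> ~~ free [:: x; y; z].
Proof.
move=> xy0 xz0 yz0; apply/negP => fxyz.
have [w xw] := exists_dot_neq0 (free_not0 fxyz (mem_head x _)).
have [xy xx] := dot_of_cross_eq0 (catl_free (fxyz : free ([:: x; y] ++ _))) xy0.
have fxz : free [:: x; z].
  apply/free2P => p q sum0.
  by have [] // := free3_eq0 (p := p) (q := 0) (r := q) fxyz; rewrite scale0r addr0.
have [xz _] := dot_of_cross_eq0 fxz xz0.
pose proj v := v - ('[v, w] / '[x, w]) *: x.
have eigen v : x *v v = 0 -> '[x, v] = 0 -> x *v w *v proj v = '[x, w] *: proj v.
  move=> xv0 xv; apply: cross_cross_eigen.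
  - by rewrite linearBr linearZr_LR /= xv0 (crossvv crossP) scaler0 subr0.
  - by rewrite linearBr linearZr_LR /= xv xx mulr0 subr0.
  by rewrite linearBl linearZl_LR /= divfK ?subrr.
have fproj : free [:: proj y; proj z].
  apply/free2P => p q sum0.
  pose r := - (p * ('[y, w] / '[x, w]) + q * ('[z, w] / '[x, w])).
  have [|_ -> ->] // := free3_eq0 (p := r) (q := p) (r := q) fxyz.
  by rewrite -sum0 /r /proj; lmod_ring.
have := cross_eigenvectors_notin xw fproj (eigen _ xy0 xy) (eigen _ xz0 xz).
rewrite !(linearBl, linearBr) !(linearZl_LR, linearZr_LR) /=.
by rewrite yz0 xz0 (crossC x y) xy0 (crossvv crossP) oppr0 !scaler0 !subr0 mem0v.
Qed.

Lemma cross_eq0_mem x y z : free [:: y; z] ->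
  x *v y = 0 -> x *v z = 0 -> y *v z = 0 -> x \in <<[:: y; z]>>%VS.
Proof.
move=> fyz xy xz yz; have := cross_eq0_dependent xy xz yz.
by rewrite free_cons fyz andbT negbK.
Qed.

Lemma exists_cross_neq0 B : \dim B = 3%N ->
  exists x y, [/\ x \in B, y \in B & x *v y != 0].
Proof.
move=> dimB; have [x [y [z bB]]] := dim3_basis dimB.
have [xB yB zB] : [/\ x \in B, y \in B & z \in B].
  by split; apply: (basis_mem bB); rewrite !inE eqxx ?orbT.
have [xy0|] := eqVneq (x *v y) 0; last by exists x, y.
have [xz0|] := eqVneq (x *v z) 0; last by exists x, z.
have [yz0|] := eqVneq (y *v z) 0; last by exists y, z.
by have := cross_eq0_dependent xy0 xz0 yz0; rewrite (basis_free bB).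
Qed.

Lemma exists_cross_eigenvector x y :
  x *v y \in <<[:: x; y]>>%VS -> x *v y != 0 ->
  exists h v k, [/\ h \in <<[:: x; y]>>%VS, v \in <<[:: x; y]>>%VS, v != 0, k != 0
    & h *v v = k *: v].
Proof.
have [xU yU] := mem_span2 x y => xyU nz_xy; have [p [q xyE]] := mem_span2P _ _ _ xyU.
have [q0|nzq] := eqVneq q 0; last first.
  exists x, (x *v y), q; split=> //.
  by rewrite {1}xyE linearDr !linearZr_LR /= (crossvv crossP) scaler0 add0r.
rewrite q0 scale0r addr0 in xyE.
exists y, x, (- p); split=> //; last by rewrite crossC xyE scaleNr.
  by apply: contraNneq nz_xy => ->; rewrite linear0l.
by rewrite oppr_eq0; apply: contraNneq nz_xy => p0; rewrite xyE p0 scale0r.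
Qed.

Lemma exists_cross_notin B : \dim B = 3%N ->
  exists x y, [/\ x \in B, y \in B & x *v y \notin <<[:: x; y]>>%VS].
Proof.
move=> dimB; have [x [y [xB yB nz_xy]]] := exists_cross_neq0 dimB.
have [xyU|Nxy] := boolP (x *v y \in <<[:: x; y]>>%VS); last by exists x, y.
have UB := subvP (span2_subv xB yB).
have [h [v [k [/UB hB /UB vB nz_v nzk hv]]]] := exists_cross_eigenvector xyU nz_xy.
have fhv := free_cross_eigen nzk hv nz_v.
have [z zB Nz] : exists2 z, z \in B & z \notin <<[:: h; v]>>%VS.
  by apply/subvPn; apply/negP => /dimvS; rewrite dimB (eqP fhv).
have [hz|Nhz] := boolP (h *v z \in <<[:: h; z]>>%VS); last by exists h, z.
have [hvz|Nhvz] := boolP (h *v (v + z) \in <<[:: h; (v + z)%R]>>%VS); last first.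
  by exists h, (v + z); rewrite memvD.
have fhvz : free [:: h; v; z].
  rewrite -(perm_free (permEl (perm_catC [:: z] [:: h; v]))) /= free_cons Nz.
  exact: fhv.
have [r hzr] := cross_eigen_extend nzk fhvz hv hz hvz.
exists v, (z + r *: h); split=> //; first by rewrite memvD ?memvZ.
apply: (cross_eigenvectors_notin nzk _ hv hzr).
apply/free2P => p q sum0.
have [|_ -> ->] // := free3_eq0 (p := q * r) (q := p) (r := q) fhvz.
by rewrite -sum0; lmod_ring.
Qed.

Lemma cross_cross_of_associator_eq0 x y z :
  associator x y z = 0 -> x *v y *v z = '[z, x] *: y - '[z, y] *: x.
Proof.
move=> assoc0; have := associator_rot z x y; rewrite assoc0 /associator (crossC (x *v y)).
by move/esym/eqP; rewrite -addrA addr_eq0 => /eqP/oppr_inj.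
Qed.

Lemma scale_dot_cross_mem x y z (p := x *v y) : associator x y z = 0 ->
  '[p, z] *: p - '[p, p] *: z \in <<[:: x; y]>>%VS.
Proof.
move=> assoc0; have [xU yU] := mem_span2 x y.
rewrite -(cross_crossK crossP) (cross_cross_of_associator_eq0 assoc0).
rewrite linearBr !linearZr_LR /= cross_crossl cross_crossr.
by rewrite !(memvB, memvZ).
Qed.

Lemma associator_anisotropic_mem x y z : '[x *v y, x *v y] != 0 ->
  associator x y z = 0 -> z \in cross_span x y.
Proof.
set p := x *v y => nz_pp /scale_dot_cross_mem; rewrite -/p => pzU.
have := rpredZeq (cross_span x y) '[p, p] z; rewrite (negbTE nz_pp) /= => <-.
rewrite -[X in X \in _](subKr ('[p, z] *: p)) memvB ?memvZ ?mem_cross_span //.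
exact: subvP (span2_sub_cross_span x y) _ pzU.
Qed.

Lemma dot_cross_of_isotropic x y z : '[x *v y, x *v y] = 0 ->
  associator x y z = 0 -> x *v y \notin <<[:: x; y]>>%VS -> '[x *v y, z] = 0.
Proof.
move=> pp0 /scale_dot_cross_mem + Nxy; rewrite pp0 scale0r subr0 rpredZeq (negbTE Nxy).
by rewrite orbF => /eqP.
Qed.

(* For [w] in [{x, y}], the product [w *v (z *v (z *v (x *v y)))] vanishes, and it is
   a combination of [x] and [y] with coefficients ['[z, w] * '[z, y]] and
   ['[z, w] * '[z, x]], up to signs. *)
Lemma dot_of_isotropic_plane x y z : '[x, x] = 0 -> '[x, y] = 0 -> '[y, y] = 0 ->
  associator x y z = 0 -> x *v y \notin <<[:: x; y]>>%VS -> '[z, x] = 0 /\ '[z, y] = 0.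
Proof.
move=> xx xy yy assoc0 Nxy.
have pz : '[x *v y, z] = 0.
  by apply: dot_cross_of_isotropic; rewrite // dot_cross_cross xx xy expr0n mul0r subrr.
have vanish w : w *v (x *v y) = 0 -> w *v (x *v z) = '[z, w] *: x ->
    w *v (y *v z) = '[z, w] *: y -> '[z, w] * '[z, y] = 0 /\ '[z, w] * '[z, x] = 0.
  move=> wp wxz wyz; have : w *v (z *v (z *v (x *v y))) = 0.
    rewrite (cross_crossK crossP) dotC pz scale0r sub0r linearNr linearZr_LR /= wp.
    by rewrite scaler0 oppr0.
  rewrite (crossC (x *v y)) (cross_cross_of_associator_eq0 assoc0).
  rewrite !(linearNr, linearBr) !linearZr_LR /= (crossC x z) (crossC y z) !linearNr /=.
  rewrite wxz wyz => E; have [/eqP] : - ('[z, w] * '[z, y]) = 0 /\ '[z, w] * '[z, x] = 0.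
    by apply: ((free2P _ _).1 (free_of_cross_notin Nxy)); rewrite -[RHS]E; lmod_ring.
  by rewrite oppr_eq0 => /eqP.
have [] : '[z, x] * '[z, y] = 0 /\ '[z, x] * '[z, x] = 0.
  apply: vanish.
  - by rewrite (cross_crossK crossP) xx xy !scale0r subrr.
  - by rewrite (cross_crossK crossP) xx scale0r subr0 dotC.
  by move: assoc0; rewrite /associator xy scale0r addr0 (dotC x z) => /subr0_eq.
have [] : '[z, y] * '[z, y] = 0 /\ '[z, y] * '[z, x] = 0.
  apply: vanish.
  - by rewrite (crossC (x *v y)) cross_crossr xy yy !scale0r subrr oppr0.
  - have := associatorC12 x y z; rewrite assoc0 oppr0 /associator (dotC y x) xy scale0r addr0.
    by rewrite (dotC y z) => /subr0_eq.
  by rewrite (cross_crossK crossP) yy scale0r subr0 dotC.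
by move=> /eqP + _ _ /eqP; rewrite !mulf_eq0 !orbb => /eqP-> /eqP->.
Qed.

Lemma free_cross_of_notin x y : x *v y \notin <<[:: x; y]>>%VS -> free [:: x *v y; y].
Proof.
move=> Nxy; have fxy := free_of_cross_notin Nxy.
rewrite free_cons (catr_free (fxy : free ([:: x] ++ [:: y]))) andbT.
by apply: contraNN Nxy; apply: (subvP (sub_span (@mem_behead _ [:: x; y]))).
Qed.

(* With [q = y *v z], the products of [p = x *v y] and [q] with each other and with
   [x] and [y] all vanish. *)
Lemma associator_isotropic_plane_mem x y z : '[x, x] = 0 -> '[x, y] = 0 -> '[y, y] = 0 ->
  associator x y z = 0 -> x *v y \notin <<[:: x; y]>>%VS -> z \in cross_span x y.
Proof.
move=> xx xy yy assoc0 Nxy; set p := x *v y; pose q := y *v z.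
have [zx zy] := dot_of_isotropic_plane xx xy yy assoc0 Nxy.
have pz : '[p, z] = 0.
  by apply: dot_cross_of_isotropic; rewrite // dot_cross_cross xx xy expr0n mul0r subrr.
have px : x *v p = 0 by rewrite (cross_crossK crossP) xx xy !scale0r subrr.
have py : y *v p = 0 by rewrite crossC cross_crossr xy yy !scale0r subrr oppr0.
have pz0 : p *v z = 0 by rewrite (cross_cross_of_associator_eq0 assoc0) zx zy !scale0r subr0.
have qx : x *v q = 0.
  by move: assoc0; rewrite /associator xy (dotC x z) zx !scale0r subr0 addr0.
have qy : y *v q = 0 by rewrite (cross_crossK crossP) yy dotC zy !scale0r subr0.
have qp : q *v p = 0.
  have := associator_rot z p y; rewrite /associator (crossC y p) py oppr0 linear0r.
  rewrite dot_crossr (dotC z p) pz zy !scale0r !subr0 !addr0 crossC => /eqP.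
  by rewrite oppr_eq0 => /eqP.
have fpy := free_cross_of_notin Nxy.
have [/vlineP[r qE]|Nq] := boolP (q \in <[p]>%VS).
  apply: (@mem_span_addZ _ _ _ _ _ _ r).
  apply: cross_eq0_mem => //; last by rewrite crossC py oppr0.
    by rewrite linearDl linearZl_LR /= (crossC p z) pz0 px scaler0 oppr0 addr0.
  by rewrite linearDl linearZl_LR /= (crossC y z) -/q -/p qE addrC subrr.
have fqp : free [:: q; p].
  by rewrite free_cons span_seq1 Nq seq1_free (free_not0 fpy) ?mem_head.
have xyU : (<<[:: x; y]>> <= <<[:: q; p]>>)%VS by apply: span2_subv; apply: cross_eq0_mem.
have /eqP xy_qp : <<[:: x; y]>>%VS == <<[:: q; p]>>%VS.
  by rewrite eqEdim xyU (eqP fqp) (eqP (free_of_cross_notin Nxy)).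
by case/negP: Nxy; rewrite xy_qp (mem_span2 q p).2.
Qed.

(* If ['[x, x] != 0], then [y], [p = x *v y] and the projection of [z] to the orthogonal
   of [x] have pairwise products zero. *)
Lemma associator_degenerate_plane_mem x y z : '[x, y] = 0 -> '[y, y] = 0 ->
  associator x y z = 0 -> x *v y \notin <<[:: x; y]>>%VS -> z \in cross_span x y.
Proof.
move=> xy yy assoc0 Nxy; have [xx|nz_xx] := eqVneq '[x, x] 0.
  exact: associator_isotropic_plane_mem.
set p := x *v y; have fpy := free_cross_of_notin Nxy.
have pp : '[p, p] = 0 by rewrite dot_cross_cross xy yy expr0n mulr0 subrr.
have pz : '[p, z] = 0 by apply: dot_cross_of_isotropic.
have px : p *v x = '[x, x] *: y by rewrite cross_crossl xy scale0r subr0.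
have py : p *v y = 0 by rewrite cross_crossr xy yy !scale0r subrr.
have pzE : p *v z = '[z, x] *: y - '[z, y] *: x by apply: cross_cross_of_associator_eq0.
have zy : '[z, y] = 0.
  have nz_y : y != 0 by rewrite (free_not0 fpy) // !inE eqxx orbT.
  have := cross_crossK crossP p z; rewrite pzE linearBr !linearZr_LR /= px py pp pz.
  move/eqP; rewrite !scale0r scaler0 subrr sub0r oppr_eq0 scalerA scaler_eq0 mulf_eq0.
  by rewrite (negbTE nz_y) (negbTE nz_xx) !orbF => /eqP.
pose t := '[z, x] / '[x, x]; pose w := z - t *: x.
have pw : p *v w = 0.
  by rewrite linearBr linearZr_LR /= pzE zy px scale0r subr0 scalerA divfK // subrr.
have xw : '[x, w] = 0 by rewrite linearBr linearZr_LR /= (dotC x z) divfK // subrr.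
have assoc_w : associator x y w = 0.
  rewrite (linearB (associator x y)) (linearZ_LR (associator x y)) /=.
  by rewrite assoc0 associatorxyx scaler0 subrr.
have yw : y *v w = 0.
  have xyw : x *v (y *v w) = 0.
    by move: assoc_w; rewrite /associator xy xw !scale0r subr0 addr0.
  have := cross_crossK crossP x (y *v w).
  rewrite xyw linear0r -(dot_crossA crossP) linearBr linearZr_LR /= pz dot_crossl.
  rewrite mulr0 subr0 scale0r sub0r => /esym/eqP.
  by rewrite oppr_eq0 scaler_eq0 (negbTE nz_xx) => /eqP.
apply: (@mem_span_addZ _ _ _ _ _ _ (- t)); rewrite scaleNr -/w.
by apply: cross_eq0_mem; rewrite // crossC ?pw ?yw oppr0.
Qed.

Theorem associator_eq0_mem x y z : associator x y z = 0 ->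
  x *v y \notin <<[:: x; y]>>%VS -> z \in cross_span x y.
Proof.
move=> assoc0 Nxy; have [pp|nz_pp] := eqVneq '[x *v y, x *v y] 0; last first.
  exact: associator_anisotropic_mem.
have [xU yU] := mem_span2 x y; rewrite dot_cross_cross in pp.
have [xx|nz_xx] := eqVneq '[x, x] 0.
  apply: (subvP (cross_spanS yU xU)); apply: associator_degenerate_plane_mem => //.
  - by move/eqP: pp; rewrite xx mul0r sub0r oppr_eq0 sqrf_eq0 dotC => /eqP.
  - by rewrite associatorC12 assoc0 oppr0.
  by rewrite crossC memvN; apply: contraNN Nxy; apply: subvP; apply: span2_subv.
pose t := '[x, y] / '[x, x]; pose w := y - t *: x.
have wU : w \in <<[:: x; y]>>%VS by rewrite memvB ?memvZ.
have xwE : x *v w = x *v y.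
  by rewrite linearBr linearZr_LR /= (crossvv crossP) scaler0 subr0.
have xw : '[x, w] = 0 by rewrite linearBr linearZr_LR /= divfK ?subrr.
apply: (subvP (cross_spanS xU wU)); apply: associator_degenerate_plane_mem => //.
- have /esym/eqP := dot_cross_cross x w.
  by rewrite xwE dot_cross_cross pp xw expr0n subr0 mulf_eq0 (negbTE nz_xx) => /eqP.
- rewrite associatorC23 (linearB (associator x z)) (linearZ_LR (associator x z)) /=.
  by rewrite associatorxyx scaler0 subr0 -associatorC23.
by rewrite xwE; apply: contraNN Nxy; apply: subvP; apply: span2_subv.
Qed.

Lemma associative_block_eq B x y : associative_block B -> x \in B -> y \in B ->
  x *v y \notin <<[:: x; y]>>%VS -> B = cross_span x y.
Proof.
move=> [dimB assocB] xB yB Nxy; apply/eqP; rewrite eqEdim dimB dim_span andbT.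
by apply/subvP => z zB; apply: associator_eq0_mem; rewrite ?assocB.
Qed.

Lemma associative_block_unique B B' x y : associative_block B -> associative_block B' ->
  x \in B -> y \in B -> x \in B' -> y \in B' -> x *v y \notin <<[:: x; y]>>%VS -> B' = B.
Proof.
move=> blockB blockB' xB yB xB' yB' Nxy.
by rewrite (associative_block_eq blockB' xB' yB' Nxy) (associative_block_eq blockB xB yB Nxy).
Qed.

Definition associator_form x y u v := '[associator x y u, v].

Fact associator_form_is_bilinear x y : bilinear_for *%R *%R (associator_form x y).
Proof.
split=> [w|u] k v v1; rewrite /associator_form /=.
  by rewrite linearP linearDl linearZl_LR.
by rewrite linearDr linearZr_LR.
Qed.

HB.instance Definition _ x y :=
  bilinear_isBilinear.Build F V V F *%R *%R (associator_form x y) (associator_form_is_bilinear x y).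

Fact associator_form_is_skew x y u v :
  associator_form x y u v = (-1) ^+ true * idfun (associator_form x y v u).
Proof. by rewrite mulN1r /=; exact: dot_associator_skew. Qed.

HB.instance Definition _ x y :=
  isHermitianSesquilinear.Build F V true idfun (associator_form x y) (associator_form_is_skew x y).

Lemma exists_associator_eq0 x y : odd (\dim {:V}) -> free [:: x; y] ->
  exists2 z, z \notin <<[:: x; y]>>%VS & associator x y z = 0.
Proof.
move=> odd_dimV fxy; pose s : {skew_symmetric V} := associator_form x y.
have [z z_rad Nz] : exists2 z, z \in orthov s fullv & z \notin <<[:: x; y]>>%VS.
  apply/subvPn; apply/negP => rad_xy.
  have := odd_dim_cap_orthov s nz2 fullv; rewrite capfv odd_dimV.
  suff -> : orthov s fullv = <<[:: x; y]>>%VS by rewrite (eqP fxy).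
  apply: subv_anti; rewrite rad_xy; apply: span2_subv; apply/mem_orthovP => v _.
    by rewrite /s /= /associator_form associatorxyx linear0l.
  by rewrite /s /= /associator_form associatorxyy linear0l.
exists z => //; apply/eqP/negPn/negP => /exists_dot_neq0[w].
by have /mem_orthovP/(_ w (memvf w)) := z_rad; rewrite /s /= /associator_form => ->; rewrite eqxx.
Qed.

Lemma exists_associative_block T : odd (\dim {:V}) -> \dim T = 2%N ->
  exists2 B, associative_block B & (T <= B)%VS.
Proof.
move=> odd_dimV /dim2_basis[x [y bT]]; have fxy := basis_free bT.
have [z Nz assoc0] := exists_associator_eq0 odd_dimV fxy.
have fzxy : free [:: z; x; y] by rewrite free_cons Nz.
exists <<[:: z; x; y]>>%VS; last first.
  rewrite -(span_basis bT); exact: (sub_span (@mem_behead _ [:: z; x; y])).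
by split; [apply/eqP | apply: associator_span3; rewrite -associator_rot].
Qed.

End CrossProduct.

(** * Laplace expansion along coordinate rows *)

Lemma det_mx33 (R : comNzRingType) (A : 'M[R]_3) :
  \det A = A 0 0 * (A 1 1 * A 2 2 - A 1 2 * A 2 1)
         - A 0 1 * (A 1 0 * A 2 2 - A 1 2 * A 2 0)
         + A 0 2 * (A 1 0 * A 2 1 - A 1 1 * A 2 0).
Proof.
pose B i j := A (inord i) (inord j).
have AB i j : A i j = B i j by rewrite /B !inord_val.
rewrite (expand_det_row _ 0) !big_ord_recl big_ord0 /cofactor !(expand_det_row _ 0).
rewrite !big_ord_recl !big_ord0 /cofactor !det_mx11 !mxE !AB /= /bump /=.
ring.
Qed.

Section Laplace.
Variable R : comNzRingType.

Definition mxcols n (A : nat -> nat -> R) (cs : seq nat) : 'M[R]_n :=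
  \matrix_(i < n, j < n) A i (nth 0%N cs j).

Lemma det_mxcols_delta n (A : nat -> nat -> R) (cs : seq nat) (p : nat) :
  uniq cs -> size cs = n.+1 -> {in cs, forall k, A 0%N k = (k == p)%:R} ->
  \det (mxcols n.+1 A cs) =
  if p \in cs then (-1) ^+ index p cs * \det (mxcols n (fun i => A i.+1) (rem p cs))
  else 0.
Proof.
move=> ucs scs A0; rewrite (expand_det_row _ ord0).
have A0E (j : 'I_n.+1) : A 0%N (nth 0%N cs j) = (nth 0%N cs j == p)%:R.
  by apply/A0/mem_nth; rewrite scs.
case: ifPn => [pcs | pNcs]; last first.
  apply: big1 => j _; rewrite mxE A0E (_ : _ == p = false) ?mul0r //.
  by apply/negbTE; apply: contraNneq pNcs => <-; apply: mem_nth; rewrite scs.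
have lt_i : (index p cs < n.+1)%N by rewrite -scs index_mem.
rewrite (bigD1 (Ordinal lt_i)) //= big1 ?addr0 => [|j ne_j]; last first.
  rewrite mxE A0E (_ : _ == p = false) ?mul0r //; apply: contraNF ne_j => /eqP def_p.
  by rewrite -val_eqE /= -def_p index_uniq ?scs.
rewrite mxE A0E nth_index // eqxx mul1r /cofactor add0n; congr (_ * \det _).
apply/matrixP => i j; rewrite !mxE remE /= nth_cat size_take scs lt_i /bump.
case: ltnP => hj; first by rewrite nth_take.
by rewrite nth_drop addSn subnKC.
Qed.

(* Laplace expansion of a determinant with columns [cs] along rows
   [e_p], [p] in [ps]: [Some (s, r)] if it leaves the columns [r] with sign
   [(-1) ^+ s], and [None] if the determinant is zero. *)
Fixpoint cofactors (ps cs : seq nat) : option (bool * seq nat) :=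
  if ps is p :: ps' then
    if p \in cs then
      if cofactors ps' (rem p cs) is Some (s, r) then Some (odd (index p cs) (+) s, r)
      else None
    else None
  else Some (false, cs).

Lemma det_mxcols_deltas n (ps : seq nat) (A : nat -> nat -> R) (cs : seq nat) :
  uniq cs -> size cs = (size ps + n)%N ->
  (forall i, (i < size ps)%N -> {in cs, forall k, A i k = (k == nth 0%N ps i)%:R}) ->
  \det (mxcols (size ps + n) A cs) =
  if cofactors ps cs is Some (s, r) then
    (-1) ^+ s * \det (mxcols n (fun i => A (size ps + i)%N) r)
  else 0.
Proof.
elim: ps A cs => [|p ps IHps] A cs ucs scs Aps /=; first by rewrite expr0 mul1r.
rewrite (@det_mxcols_delta _ _ _ p) //; last exact: (Aps 0%N).
case: ifP => // pcs; rewrite IHps ?rem_uniq ?size_rem ?scs //; last first.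
  by move=> i lt_i k /mem_rem; apply: (Aps i.+1).
case: (cofactors ps _) => [[s r]|]; rewrite ?mulr0 // mulrA; congr (_ * _).
by rewrite signr_addb signr_odd.
Qed.

Lemma size_cofactors n (ps cs : seq nat) s r :
  uniq cs -> size cs = (size ps + n)%N -> cofactors ps cs = Some (s, r) -> size r = n.
Proof.
elim: ps cs s => [|p ps IHps] cs s ucs scs /=; first by case=> _ <-.
case: ifP => // pcs; case E: (cofactors _ _) => [[s' r']|] // [_ def_r].
by move: E; rewrite def_r; apply: IHps; rewrite ?rem_uniq ?size_rem ?scs.
Qed.

End Laplace.

(** * Imaginary Cayley numbers *)

Section Coordinates.
Variable F : fieldType.
Implicit Types (x y z : 'rV[F]_7) (eps : bool).

Definition coord x (i : nat) : F := x 0 (inord i).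

Lemma coordE x (k : 'I_7) : x 0 k = coord x k.
Proof. by rewrite /coord inord_val. Qed.

Lemma coordD x y i : coord (x + y) i = coord x i + coord y i.
Proof. by rewrite /coord mxE. Qed.

Lemma coordN x i : coord (- x) i = - coord x i.
Proof. by rewrite /coord mxE. Qed.

Lemma coordZ p x i : coord (p *: x) i = p * coord x i.
Proof. by rewrite /coord mxE. Qed.

Lemma coord_e (j : 'I_7) i : (i < 7)%N -> coord (e F j) i = (i == j)%:R.
Proof. by move=> lt_i; rewrite /coord mxE eqxx -val_eqE /= inordK. Qed.

Definition minor2 x y (i j : nat) : F := coord x i * coord y j - coord x j * coord y i.

Definition minor3 x y z (i j k : nat) : F :=
  coord x i * minor2 y z j k - coord x j * minor2 y z i k + coord x k * minor2 y z i j.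

Lemma wedge7E (ps : seq 'I_7) x y z : size ps = 4%N ->
  wedge7 (map (e F) ps ++ [:: x; y; z]) =
  if cofactors (map val ps) (iota 0 7) is Some (s, [:: i; j; k]) then
    (-1) ^+ s * minor3 x y z i j k
  else 0.
Proof.
move=> sps; set vs := map (e F) ps ++ _.
have szp : size (map val ps) = 4%N by rewrite size_map.
rewrite /wedge7 (_ : rows7 vs = mxcols 7 (fun i k => coord (nth 0 vs i) k) (iota 0 7)).
  have := @det_mxcols_deltas F 3 (map val ps) (fun i k => coord (nth 0 vs i) k) (iota 0 7).
  rewrite szp => -> //; last first.
    move=> i lt_i k; rewrite mem_iota /= add0n => lt_k.
    rewrite nth_cat size_map sps lt_i (nth_map 0) ?sps // coord_e //.
    by rewrite (nth_map 0) ?sps.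
  case E : (cofactors _ _) => [[s r]|] //.
  have sr : size r = 3%N by apply: (size_cofactors _ _ E); rewrite ?szp.
  case: r sr {E} => [|i [|j [|k []]]] // _; congr (_ * _).
  by rewrite det_mx33 !mxE /= /vs !nth_cat !size_map sps.
by apply/matrixP => i k; rewrite !mxE (nth_iota _ _ (ltn_ord k)) add0n coordE.
Qed.

Variables a b c : F.

(* [v_0, v_1, v_2, v_3, v_4, v_6, v_5] play the roles of [i, j, k, ij, jk, ki]
   and of a product of [i, j, k]. *)
Definition im_norm (i : nat) : F :=
  nth 0 [:: - a; - b; - c; a * b; b * c; - (a * b * c); c * a] i.

Definition im_dot x y : F := \sum_(i < 7) im_norm i * x 0 i * y 0 i.

(* In [im_dot (im_cross x y) z] the minor on the line [l_n] has coefficient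
   [- a b c / h(l_n)]. *)
Definition im_cross_coord x y (k : nat) : F :=
  match k with
  | 0%N => - b * minor2 x y 1 3 + b * c * minor2 x y 4 5 - c * minor2 x y 2 6
  | 1%N => - a * minor2 x y 3 0 - c * minor2 x y 2 4 + a * c * minor2 x y 5 6
  | 2%N => - b * minor2 x y 4 1 + a * b * minor2 x y 3 5 - a * minor2 x y 6 0
  | 3%N => minor2 x y 0 1 - c * minor2 x y 5 2 - c * minor2 x y 4 6
  | 4%N => minor2 x y 1 2 - a * minor2 x y 6 3 - a * minor2 x y 5 0
  | 5%N => minor2 x y 2 3 + minor2 x y 0 4 + minor2 x y 6 1
  | _ => - b * minor2 x y 3 4 - b * minor2 x y 1 5 + minor2 x y 0 2
  end.

Definition im_cross x y : 'rV[F]_7 := \row_(k < 7) im_cross_coord x y k.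

Lemma coord_im_cross x y i : (i < 7)%N -> coord (im_cross x y) i = im_cross_coord x y i.
Proof. by move=> lt_i; rewrite /coord mxE inordK. Qed.

Lemma im_dotE x y :
  im_dot x y = - a * coord x 0 * coord y 0 - b * coord x 1 * coord y 1
    - c * coord x 2 * coord y 2 + a * b * coord x 3 * coord y 3
    + b * c * coord x 4 * coord y 4 - a * b * c * coord x 5 * coord y 5
    + c * a * coord x 6 * coord y 6.
Proof.
by rewrite /im_dot !big_ord_recl big_ord0 !coordE /im_norm /= /bump !add1n; ring.
Qed.

Lemma im_dot_e x j : im_dot x (e F j) = im_norm j * x 0 j.
Proof.
rewrite /im_dot (bigD1 j) //= big1 => [|i ne_ij]; first by rewrite mxE !eqxx mulr1 addr0.
by rewrite mxE (negbTE ne_ij) andbF mulr0.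
Qed.

Fact im_dot_is_bilinear : bilinear_for *%R *%R im_dot.
Proof. by split=> u k x y; rewrite /= !im_dotE !(coordD, coordZ); ring. Qed.

HB.instance Definition _ :=
  bilinear_isBilinear.Build F _ _ _ *%R *%R im_dot im_dot_is_bilinear.

Fact im_dot_is_symmetric x y : im_dot x y = (-1) ^+ false * idfun (im_dot y x).
Proof. by rewrite expr0 mul1r /= !im_dotE; ring. Qed.

HB.instance Definition _ :=
  isHermitianSesquilinear.Build F _ false idfun im_dot im_dot_is_symmetric.

Fact im_cross_is_bilinear : bilinear_for *:%R *:%R im_cross.
Proof.
split=> u k x y; apply/rowP => i; rewrite !mxE /im_cross_coord /minor2.
  by case: (val i) => [|[|[|[|[|[|?]]]]]]; rewrite !(coordD, coordZ); ring.
by case: (val i) => [|[|[|[|[|[|?]]]]]]; rewrite !(coordD, coordZ); ring.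
Qed.

HB.instance Definition _ :=
  bilinear_isBilinear.Build F _ _ _ *:%R *:%R im_cross im_cross_is_bilinear.

Lemma im_cross_product : cross_product im_dot im_cross.
Proof.
split=> [x|x y z|x y].
- apply/rowP => k; rewrite !mxE /im_cross_coord /minor2.
  by case: (val k) => [|[|[|[|[|[|?]]]]]]; ring.
- by rewrite /= !im_dotE !coord_im_cross // /im_cross_coord /minor2; ring.
apply/rowP => k; rewrite /= !coordE coord_im_cross // coordD coordN !coordZ !im_dotE.
case: k => [[|[|[|[|[|[|[|//]]]]]]] lt_k];
  by rewrite /= /im_cross_coord /minor2 !coord_im_cross //= /minor2; ring.
Qed.

Local Notation im_associator := (associator im_dot im_cross).
Local Notation im_block := (associative_block im_dot im_cross).

Lemma dot_im_associator_e eps (j : 'I_7) x y z :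
  im_dot (im_associator x y z) (e F j)
  = - (-1) ^+ eps * (a * b * c) * Defs.eta a b c eps j x y z.
Proof.
have -> : Defs.eta a b c eps j x y z = \sum_(n < 7) hw a b c n * wedge7 (map (e F) (j ::
    if eps then [:: addI7 n 1; n; addI7 n 3] else [:: n; addI7 n 1; addI7 n 3])
    ++ [:: x; y; z]).
  by apply: eq_bigr => n _; case: (eps).
under eq_bigr => n _ do (rewrite wedge7E; last by case: (eps)).
rewrite !big_ord_recl big_ord0 /= /hw /addI7 /=.
rewrite /associator im_dotE /= !(coordD, coordN, coordZ) !coord_im_cross // !im_dotE !coord_e //.
rewrite /im_cross_coord /minor2 !coord_im_cross // /im_cross_coord /minor3 /minor2.
case: eps; rewrite /= !inordK //;
  by case: j => [[|[|[|[|[|[|[|//]]]]]]] lt_j]; rewrite /= ?expr0 ?expr1; ring.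
Qed.

Hypotheses (nza : a != 0) (nzb : b != 0) (nzc : c != 0).

Lemma im_norm_neq0 (i : 'I_7) : im_norm i != 0.
Proof.
by case: i => [[|[|[|[|[|[|[|//]]]]]]] lt_i]; rewrite /im_norm /= ?oppr_eq0 ?mulf_neq0.
Qed.

Lemma im_dot_e_eq0 x : (forall j, im_dot x (e F j) = 0) -> x = 0.
Proof.
move=> x0; apply/rowP => j; have /eqP := x0 j.
by rewrite im_dot_e mulf_eq0 (negbTE (im_norm_neq0 j)) mxE => /eqP.
Qed.

Lemma im_dot_nondegenerate : nondegenerate (im_dot : {symmetric 'rV[F]_7}).
Proof.
rewrite /nondegenerate -subv0; apply/subvP => x /mem_orthovP x0; rewrite memv0.
by apply/eqP/im_dot_e_eq0 => j; apply: x0; rewrite memvf.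
Qed.

Lemma im_associator_eq0 eps x y z :
  (forall j, Defs.eta a b c eps j x y z = 0) <-> im_associator x y z = 0.
Proof.
split=> [eta0|assoc0 j].
  by apply: im_dot_e_eq0 => j; rewrite (dot_im_associator_e eps) eta0 mulr0.
have /esym/eqP := dot_im_associator_e eps j x y z.
rewrite assoc0 linear0l mulf_eq0 => /orP[|/eqP //].
by rewrite mulf_eq0 oppr_eq0 signr_eq0 !mulf_eq0 (negbTE nza) (negbTE nzb) (negbTE nzc).
Qed.

Lemma frakBP eps B : frakB a b c eps B <-> im_block B.
Proof.
split=> [[dimB eta0]|[dimB assocB]]; split=> //; last first.
  move=> bs /basis_mem bsB; apply/im_associator_eq0.
  by apply: assocB; apply/bsB/mem_tnth.
have [x [y [z bB]]] := dim3_basis dimB; rewrite -(span_basis bB).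
apply: (associator_span3 im_cross_product); apply/(im_associator_eq0 eps) => j.
exact: (eta0 [tuple x; y; z] bB).
Qed.

Lemma im_dot_anisotropic :
  (forall l : 'I_8 -> F, octonion_form a b c l = 0 -> forall i, l i = 0) ->
  forall x, im_dot x x = 0 -> x = 0.
Proof.
move=> aniso x xx.
pose l (i : 'I_8) := nth 0 [:: 0; coord x 0; coord x 1; coord x 2; coord x 3;
                               coord x 4; coord x 6; coord x 5] i.
have l0 : forall i, l i = 0 by apply: aniso; rewrite -[RHS]xx im_dotE /octonion_form /l /=; ring.
apply/rowP => k; rewrite coordE mxE.
by case: k => [[|[|[|[|[|[|[|//]]]]]]] lt_k];
  [exact: (l0 1) | exact: (l0 2) | exact: (l0 3) | exact: (l0 4) | exact: (l0 5)
  | exact: (l0 7) | exact: (l0 6)].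
Qed.

End Coordinates.

Theorem mainTheorem4 (F : fieldType) (a b c : F) (eps : bool) :
  2%N \notin [pchar F] -> a != 0 -> b != 0 -> c != 0 ->
  minimal_q_covering 3 2 (frakB a b c eps) /\
  ((forall l : 'I_8 -> F, octonion_form a b c l = 0 -> forall i, l i = 0) ->
   subspace_design_2_7_3_1 (frakB a b c eps)).
Proof.
rewrite inE /= => nz2 nza nzb nzc.
have crossP := im_cross_product a b c; have nondeg := im_dot_nondegenerate nza nzb nzc.
have blockP := frakBP nza nzb nzc eps.
have cover : q_covering 3 2 (frakB a b c eps).
  split=> [B [] //|T dimT]; have odd7 : odd (\dim {:'rV[F]_7}) by rewrite dimvf dim_matrix.
  by have [B /blockP] := exists_associative_block crossP nz2 nondeg odd7 dimT; exists B.
split=> [|aniso]; split; [exact: cover| |by case: cover|].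
  move=> S' S'B [_ cover'] B /blockP blockB.
  have [x [y [xB yB Nxy]]] := exists_cross_notin crossP nz2 nondeg blockB.1.
  have [B' [S'B' /subvP xyB']] := cover' _ (eqP (free_of_cross_notin crossP Nxy)).
  have [/xyB' xB' /xyB' yB'] := mem_span2 x y; have /blockP blockB' := S'B _ S'B'.
  by rewrite (associative_block_unique crossP nz2 nondeg blockB' blockB xB' yB').
move=> T dimT; have [B [frB TB]] := cover.2 T dimT; exists B; split=> // B' frB' TB'.
have [x [y bT]] := dim2_basis dimT; have [xT yT] := mem_span2 x y.
rewrite (span_basis bT) in xT yT; move/blockP: frB; move/blockP: frB' => blockB' blockB.
apply: (associative_block_unique crossP nz2 nondeg blockB blockB' (x := x) (y := y));
  rewrite ?(subvP TB) ?(subvP TB') //.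
apply: (cross_notin_anisotropic crossP _ (basis_free bT)).
exact: im_dot_anisotropic aniso.
Qed.
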